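(* Let $G$ be a graph and let $k \geq 2$ and $s \geq 1$ be integers. If $G$ contains neither a clique on $k$ vertices nor a minimal separator of size larger than $s$, then the treewidth of $G$ is at most $(k-1)s^3 - 1$.
   Context: All graphs are finite, simple and undirected. For two vertices $s,t \in V(G)$, a set $X \subseteq V(G)$ is an $st$-separator if $s,t \notin X$ and $s$ and $t$ lie in different connected components of $G \setminus X$. An $st$-separator is a minimal $st$-separator if it is inclusion-wise minimal among $st$-separators. A set $X \subseteq V(G)$ is a minimal separator of $G$ if there exist $s,t \in V(G)$ such that $X$ is a minimal $st$-separator in $G$. Treewidth is the usual graph parameter (minimum over tree decompositions of the maximum bag size minus one). *)

(* Defs.v *)
From HB Require Import structures.
From mathcomp Require Import all_boot all_order all_algebra.
From mathcomp Require Import boolp.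

Set Implicit Arguments.
Unset Strict Implicit.
Unset Printing Implicit Defensive.

Import GRing.Theory Num.Theory.

Record simple_graph (V : finType) := SimpleGraph {
  edge :> rel V;
  edge_sym : symmetric edge;
  edge_irr : irreflexive edge }.

Section Graph.
Variables (V : finType) (G : simple_graph V).

Definition induced (A : {set V}) : rel V := [rel x y in A | G x y].

Definition clique (K : {set V}) : bool :=
  [forall x in K, forall y in K, (x != y) ==> G x y].

(* As [connect] is reflexive, there is no separator when [s = t]. *)
Definition separator (s t : V) (X : {set V}) : bool :=
  [&& s \notin X, t \notin X & ~~ connect (induced (~: X)) s t].

Definition minimal_st_separator (s t : V) (X : {set V}) : bool :=
  minset (separator s t) X.

Definition minimal_separator (X : {set V}) : Prop :=
  exists s t : V, minimal_st_separator s t X.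

(* [ucycle G c] also holds for [c = [:: x; y]] with [x y] an edge, which is
   not a cycle of the graph. *)
Definition acyclic : Prop := forall c : seq V, ucycle G c -> size c <= 2.

Definition tree : Prop :=
  [/\ 0 < #|V|, forall x y : V, connect G x y & acyclic].

End Graph.

Definition tree_decomposition (V : finType) (G : simple_graph V)
    (I : finType) (T : simple_graph I) (B : I -> {set V}) : Prop :=
  [/\ tree T,
      forall v : V, exists i, v \in B i,
      forall u v : V, G u v -> exists i, (u \in B i) && (v \in B i)
    & forall (v : V) (i j : I), v \in B i -> v \in B j ->
        connect (induced T [set l | v \in B l]) i j].

Definition has_decomposition_of_max_bag (V : finType) (G : simple_graph V)
    (m : nat) : Prop :=
  exists (I : finType) (T : simple_graph I) (B : I -> {set V}),
    tree_decomposition G T B /\ \max_(i : I) #|B i| = m.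

Lemma has_decomposition_ex (V : finType) (G : simple_graph V) :
  exists m, `[< has_decomposition_of_max_bag G m >].
Proof.
have sym0 : symmetric (fun _ _ : unit => false) by [].
have irr0 : irreflexive (fun _ _ : unit => false) by [].
exists (\max_(i : unit) #|[set: V]|); apply/asboolP.
exists unit, (SimpleGraph sym0 irr0), (fun _ => [set: V]); split=> //; split.
- split; first by rewrite card_unit.
  + by move=> [] []; apply: connect0.
  + by move=> [|x [|y c]] //= /andP[].
- by move=> v; exists tt; rewrite inE.
- by move=> u v _; exists tt; rewrite !inE.
- by move=> v [] [] _ _; apply: connect0.
Qed.

(* An integer, so that the graph with no vertices has treewidth -1. *)
Definition treewidth (V : finType) (G : simple_graph V) : int :=
  ((ex_minn (has_decomposition_ex G))%:Z - 1)%R.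

(* Main.v *)
Require Import Defs.
From HB Require Import structures.
From mathcomp Require Import all_boot all_order all_algebra.
From mathcomp Require Import boolp zify.

(** Repeatedly turning a minimal separator that is not a clique into a clique
    ends with a supergraph in which any two nonadjacent vertices are separated by
    a clique. Such a graph has a tree decomposition whose bags are cliques, and
    its maximal cliques are potential maximal cliques: (i) any two nonadjacent
    vertices of [O] have neighbours in a common component of the complement of
    [O], and (ii) no such component has all of [O] as neighbours. Being a
    potential maximal clique pulls back along each saturation step, so [G] itself
    has a tree decomposition with each bag inside such a set [O].

    In [G], (i) and (ii) make the neighbourhood in [O] of every component a
    minimal separator, of size at most [s]. If [v] and [u] are nonadjacent in [O]
    and [X] is a minimal [v]-[u] separator, every nonneighbour [w] of [v] in [O]
    is in [X] or is a neighbour of a component meeting [X], because of the walk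
    from [v] to [w] to [u] through components. So [v] has at most [s ^ 2]
    nonneighbours in [O], and a greedy choice gives a clique on [k] vertices as
    soon as [O] has more than [(k - 1) * s ^ 3] vertices. *)

Set Implicit Arguments.
Unset Strict Implicit.
Unset Printing Implicit Defensive.

(** * Connected sets, components and minimal separators *)

Lemma connect_homo (T T' : finType) (e : rel T) (e' : rel T') (f : T -> T') :
    (forall x y, e x y -> connect e' (f x) (f y)) ->
  forall x y, connect e x y -> connect e' (f x) (f y).
Proof.
move=> fP x y /connectP[p]; elim: p x => [x _ -> //|z p IHp x] /=.
by move=> /andP[/fP xz /IHp zy] /zy; apply: connect_trans.
Qed.

Lemma connect_inv (T : finType) (e : rel T) (P : pred T) :
    (forall x y, e x y -> P x -> P y) ->
  forall x y, connect e x y -> P x -> P y.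
Proof.
move=> eP x y /connectP[p]; elim: p x => [x _ -> //|z p IHp x] /=.
by move=> /andP[/eP xz /IHp zy] /zy zy' /xz.
Qed.

Section Connected.
Variables (V : finType) (G : simple_graph V).
Implicit Types (A B C D X Y : {set V}) (u v w x y z : V).

Definition connected_set D : Prop := {in D &, forall x y, connect (induced G D) x y}.

Definition component A x : {set V} := [set y | connect (induced G A) x y].

Definition touches v D : bool := [exists d in D, G v d].

Lemma touchesP v D : reflect (exists2 d, d \in D & G v d) (touches v D).
Proof. exact: exists_inP. Qed.

Lemma touchesS v A B : A \subset B -> touches v A -> touches v B.
Proof.
move=> /subsetP AB /touchesP[d dA vd].
by apply/touchesP; exists d; rewrite ?AB.
Qed.

Lemma inducedE A x y : induced G A x y = [&& x \in A, y \in A & G x y].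
Proof. by rewrite /= andbA. Qed.

Lemma induced_csym A : connect_sym (induced G A).
Proof. by apply: sym_connect_sym => x y; rewrite !inducedE edge_sym andbCA. Qed.

Lemma connect_inducedS A B x y : A \subset B ->
  connect (induced G A) x y -> connect (induced G B) x y.
Proof.
move=> /subsetP AB; apply: (connect_homo (f := id)) => {}x {}y.
by rewrite inducedE => /and3P[xA yA xy]; apply: connect1; rewrite inducedE !AB.
Qed.

Lemma connect_induced1 A x y :
  x \in A -> y \in A -> G x y -> connect (induced G A) x y.
Proof. by move=> xA yA xy; apply: connect1; rewrite inducedE xA yA. Qed.

Lemma connect_touches A D x v : connected_set D -> D \subset A ->
  x \in D -> v \in A -> touches v D -> connect (induced G A) x v.
Proof.
move=> cD DA xD vA /touchesP[d dD vd].
apply: connect_trans (connect_inducedS DA (cD _ _ xD dD)) _.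
by apply: connect_induced1 => //; [apply: (subsetP DA) | rewrite edge_sym].
Qed.

Lemma connect_touches2 A D u v : connected_set D -> D \subset A ->
  u \in A -> v \in A -> touches u D -> touches v D -> connect (induced G A) u v.
Proof.
move=> cD DA uA vA /touchesP[d dD ud] tv.
apply: connect_trans (connect_touches cD DA dD vA tv).
by apply: connect_induced1 => //; apply: (subsetP DA).
Qed.

Lemma mem_component A x : x \in component A x.
Proof. by rewrite inE connect0. Qed.

Lemma component_sub A x : x \in A -> component A x \subset A.
Proof.
move=> xA; apply/subsetP=> y; rewrite inE => xy.
apply: (connect_inv (P := mem A)) xy xA => {}x {}y.
by rewrite inducedE => /and3P[].
Qed.

Lemma component_closed A x y z : x \in A ->
  y \in component A x -> z \in A -> G y z -> z \in component A x.
Proof.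
move=> xA yC zA yz; have yA := subsetP (component_sub xA) _ yC.
move: yC; rewrite !inE => xy; apply: connect_trans xy _.
exact: connect_induced1.
Qed.

Lemma component_connected A x : x \in A -> connected_set (component A x).
Proof.
move=> xA; suff cx y : y \in component A x ->
    connect (induced G (component A x)) x y.
  by move=> y z /cx + /cx; rewrite induced_csym; apply: connect_trans.
rewrite inE => xy.
suff /andP[] : (y \in component A x) && connect (induced G (component A x)) x y by [].
apply: (connect_inv (P := fun y => (y \in component A x)
  && connect (induced G (component A x)) x y)) xy _; last first.
  by rewrite mem_component connect0.
move=> {}y z; rewrite inducedE => /and3P[_ zA yz] /andP[yC xy].
have zC := component_closed xA yC zA yz.
by rewrite zC (connect_trans xy) // connect_induced1.
Qed.

Lemma component_max A D x : connected_set D -> D \subset A -> x \in D ->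
  D \subset component A x.
Proof.
by move=> cD DA xD; apply/subsetP => y yD; rewrite inE (connect_inducedS DA) ?cD.
Qed.

(** Walks inside [D] starting at [x] use only vertices of [A], so they can never leave [C]. *)
Lemma connected_absorb A C D x : connected_set D -> D \subset A -> x \in D -> x \in C ->
  (forall y z, y \in C -> z \in A -> G y z -> z \in C) -> D \subset C.
Proof.
move=> cD DA xD xC clC; apply/subsetP=> y yD.
apply: (connect_inv (P := mem C)) (cD _ _ xD yD) xC => u v.
by rewrite inducedE => /and3P[_ /(subsetP DA) vA uv] uC; apply: clC uv.
Qed.

(** Removing all vertices other than [u] and [v] separates them, and any separator shrinks to a
    minimal one. *)
Lemma minimal_st_separator_exists u v : u != v -> ~~ G u v ->
  exists X, minimal_st_separator G u v X.
Proof.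
move=> uv nuv; case: (@minset_exists _ (separator G u v) (~: [set u; v])).
  rewrite /separator !inE !eqxx orbT /=; apply/negP => /connect_inv H.
  have := H (pred1 u) _ (eqxx u); rewrite /= eq_sym (negPf uv) => /(_ _)/negP[] //.
  move=> x y; rewrite inducedE !inE !negbK => /and3P[_ /orP[/eqP->|/eqP->]] //=.
  by move=> xv /eqP xu; rewrite -xu xv in nuv.
by move=> X mX _; exists X.
Qed.

(** If [x] had no neighbour in the component of [u], that component would survive putting [x] back,
    so [X :\ x] would still separate [u] from [v], against minimality. *)
Lemma minimal_separator_full u v X : minimal_st_separator G u v X ->
  forall x, x \in X -> touches x (component (~: X) u).
Proof.
move=> /minsetP[/and3P[uX vX nuv] minX] x xX; apply: contraT => ntx.
have: x \in X :\ x; last by rewrite !inE eqxx.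
rewrite (minX (X :\ x)) ?subsetDl // /separator !inE (negPf uX) (negPf vX) !andbF /=.
apply: contra nuv => uv; have := connect_inv (P := mem (component (~: X) u)) _ uv.
rewrite !inE connect0; apply=> // y z; rewrite inducedE => /and3P[_ zX yz] yC.
have uX' : u \in ~: X by rewrite inE.
apply: (component_closed uX' yC) (yz); rewrite inE; apply: contra ntx => zX'.
apply/touchesP; exists y => //; rewrite edge_sym.
by move: zX; rewrite !inE zX' andbT negbK => /eqP <-.
Qed.

Lemma separator_sym u v X : separator G u v X = separator G v u X.
Proof. by rewrite /separator induced_csym andbCA. Qed.

Lemma minimal_st_separator_sym u v X :
  minimal_st_separator G u v X -> minimal_st_separator G v u X.
Proof.
move=> /minsetP[sX minX]; apply/minsetP; split; first by rewrite separator_sym.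
by move=> Y; rewrite separator_sym; apply: minX.
Qed.

End Connected.

(** * Potential maximal cliques and their size *)

(** Connected sets stand in for components of the complement of [O]: each nonempty one lies in a
    component, to which (i) passes up and from which (ii) passes down. *)
Definition potential_maximal_clique (V : finType) (G : simple_graph V)
    (O : {set V}) : Prop :=
  (forall u v, u \in O -> v \in O -> u != v -> ~~ G u v ->
     exists D, [/\ connected_set G D, D \subset ~: O, touches G u D & touches G v D])
  /\ (forall D, D != set0 -> connected_set G D -> D \subset ~: O ->
     exists2 z, z \in O & ~~ touches G z D).

Section Bound.
Variables (V : finType) (G : simple_graph V) (s : nat).
Hypothesis small_sep : forall X, minimal_separator G X -> #|X| <= s.
Variable O : {set V}.
Hypothesis pmcO : potential_maximal_clique G O.

(** The other end of the separation is the vertex [z] of [O] that (ii) leaves untouched by [C]: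
    every way out of [C] goes through [Z]. *)
Lemma pmc_neighborhood_card x : x \notin O ->
  #|[set w in O | touches G w (component G (~: O) x)]| <= s.
Proof.
move=> xO; set C := component _ _ _; set Z := finset _.
have xO' : x \in ~: O by rewrite inE.
have cC : connected_set G C by apply: component_connected.
have CO : C \subset ~: O by apply: component_sub.
have xC : x \in C by apply: mem_component.
have [|z zO ntz] := pmcO.2 C _ cC CO; first by apply/set0Pn; exists x.
apply: small_sep; exists x, z; apply/minsetP; split.
  rewrite /separator !inE (negPf xO) (negPf ntz) andbF /=.
  apply/negP => xz; suff /(subsetP CO) : z \in C by rewrite inE zO.
  apply: (connect_inv (P := mem C)) xz xC => a b; rewrite inducedE => /and3P[_ bZ ab] aC.
  apply: (component_closed xO' aC) (ab); rewrite inE.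
  move: bZ; rewrite !inE negb_and => /orP[//|]; apply: contra => _.
  by apply/touchesP; exists a => //; rewrite edge_sym.
(* Minimality: if [Y] misses some [w] of [Z], then [x] reaches [w] through [C], and [w] reaches [z]
   by an edge or, by (i), through a connected set outside [O], hence outside [Y]. *)
move=> Y /and3P[xY zY nxz] YZ; apply/eqP; rewrite eqEsubset YZ /=.
apply/subsetP=> w wZ; apply: contraR nxz => wY.
have YO : Y \subset O by apply: subset_trans YZ _; apply/subsetP=> ? /[!inE] /andP[].
have OY : ~: O \subset ~: Y by rewrite setCS.
move: (wZ); rewrite inE => /andP[wO tw].
have wY' : w \in ~: Y by rewrite inE.
have zY' : z \in ~: Y by rewrite inE.
apply: connect_trans (connect_touches cC (subset_trans CO OY) xC wY' tw) _.
have [wz|wz] := boolP (G w z); first exact: connect_induced1.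
have nwz : w != z by apply: contraNneq ntz => <-.
have [D [cD DO wD zD]] := pmcO.1 w z wO zO nwz wz.
exact: connect_touches2 cD (subset_trans DO OY) wY' zY' wD zD.
Qed.

Lemma pmc_nonneighbors_card v : v \in O -> 0 < s ->
  #|[set w in O | ~~ G v w]| <= s ^ 3.
Proof.
move=> vO s_gt0; set W := finset _.
(* As [v] is its own nonneighbour, it is split off and counted separately. *)
have vW : v \in W by rewrite inE vO edge_irr.
rewrite (cardsD1 v) vW; have [->|[u uW]] := set_0Vmem (W :\ v).
  by rewrite cards0 expn_gt0 s_gt0.
move: (uW); rewrite !inE => /and3P[uv uO nvu].
have vu : v != u by rewrite eq_sym.
have [X mX] := minimal_st_separator_exists vu nvu.
have Xs : #|X| <= s by apply: small_sep; exists v, u.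
have /minsetP[/and3P[vX uX nconn] _] := mX.
have vX' : v \in ~: X by rewrite inE.
have uX' : u \in ~: X by rewrite inE.
pose N x := [set w in O | touches G w (component G (~: O) x)].
(* What a vertex [x] of [X] accounts for: itself when it lies in [O], otherwise the neighbourhood in
   [O] of its component. *)
pose F x := if x \in O then [set x] else N x.
have F_card x : #|F x| <= s.
  by rewrite /F; case: ifPn => [_|/pmc_neighborhood_card//]; rewrite cards1.
have meet w D : w \in O -> connected_set G D -> D \subset ~: O ->
    touches G w D -> ~~ (D \subset ~: X) -> w \in \bigcup_(x in X) F x.
  move=> wO cD DO tw /subsetPn[x xD]; rewrite inE negbK => xX.
  have xO : x \notin O by move/subsetP: DO => /(_ x xD); rewrite inE.
  apply/bigcupP; exists x; rewrite // /F (negPf xO) inE wO /=.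
  exact: touchesS (component_max cD DO xD) tw.
have sub : W :\ v \subset \bigcup_(x in X) F x.
  apply/subsetP=> w; rewrite !inE => /and3P[wv wO nvw].
  have vw : v != w by rewrite eq_sym.
  have [D [cD DO vD wD]] := pmcO.1 v w vO wO vw nvw.
  have [DX|/meet] := boolP (D \subset ~: X); last exact.
  have [wX|wX] := boolP (w \in X).
    by apply/bigcupP; exists w; rewrite // /F wO set11.
  have wX' : w \in ~: X by rewrite inE.
  have c_vw := connect_touches2 cD DX vX' wX' vD wD.
  have wu : w != u by apply: contraNneq nconn => <-.
  have nwu : ~~ G w u.
    by apply: contra nconn => wu'; rewrite (connect_trans c_vw) // connect_induced1.
  have [D' [cD' DO' wD' uD']] := pmcO.1 w u wO uO wu nwu.
  have [DX'|/meet] := boolP (D' \subset ~: X); last exact.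
  case/negP: nconn; apply: connect_trans c_vw _.
  exact: connect_touches2 cD' DX' wX' uX' wD' uD'.
have W2 : #|W :\ v| <= s * s.
  apply: leq_trans (subset_leq_card sub) _.
  apply: (@leq_trans (\sum_(x in X) s)); last by rewrite sum_nat_const leq_mul2r Xs orbT.
  apply: (big_ind2 (fun (A : {set V}) n => #|A| <= n)) => [|A m B n Am Bn|//].
    by rewrite cards0.
  by apply: leq_trans (leq_add Am Bn); apply: leq_card_setU.
(* [u] and [v] are touched by one component, so [s = 1] is impossible. *)
have s2 : 1 < s.
  have [D [cD DO vD uD]] := pmcO.1 v u vO uO vu nvu.
  have /touchesP[d dD _] := vD.
  have dO : d \notin O by move/subsetP: DO => /(_ d dD); rewrite inE.
  apply: leq_trans (pmc_neighborhood_card dO).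
  have <- : #|[set v; u]| = 2 by rewrite cards2 vu.
  apply/subset_leq_card/subsetP => w /set2P[]->; rewrite inE ?vO ?uO /=;
  exact: touchesS (component_max cD DO dD) _.
(* With [v] counted, what remains is [1 + s * s <= s ^ 3], which needs [s >= 2]. *)
by rewrite !expnS expn0 muln1; nia.
Qed.

End Bound.

(** Choosing [v] and keeping only its neighbours discards at most [t] vertices, [v] included, so [k]
    rounds still leave a vertex for the last choice. *)
Lemma clique_of_few_nonneighbors (V : finType) (G : simple_graph V) (t k : nat)
    (A : {set V}) :
    (forall v, v \in A -> #|[set w in A | ~~ G v w]| <= t) -> k * t < #|A| ->
  exists2 K : {set V}, K \subset A & clique G K /\ #|K| = k.+1.
Proof.
elim: k A => [|k IHk] A At cA.
  have /card_gt0P[v vA] : 0 < #|A| by exact: leq_ltn_trans cA.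
  exists [set v]; first by rewrite sub1set.
  split; last by rewrite cards1.
  by do 2![apply/forall_inP => ? /set1P->]; rewrite eqxx.
have /card_gt0P[v vA] : 0 < #|A| by exact: leq_ltn_trans cA.
pose B := [set w in A | G v w].
have cAB : #|A| = #|B| + #|[set w in A | ~~ G v w]|.
  rewrite -(cardsID [set w | G v w] A); congr (_ + _);
  by apply: eq_card => w; rewrite !inE // andbC.
have [|| K KB [clK cK]] := IHk B.
- move=> w /[!inE] /andP[wA _]; apply: leq_trans (At w wA).
  by apply/subset_leq_card/subsetP=> x; rewrite !inE => /andP[/andP[->]].
- by have := At v vA; lia.
have vK : v \notin K by apply/negP=> /(subsetP KB); rewrite inE edge_irr andbF.
have KP w : w \in K -> w \in A /\ G v w by move/(subsetP KB); rewrite inE => /andP.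
exists (v |: K); rewrite ?cardsU1 ?vK ?cK.
  by rewrite subUset sub1set vA; apply/subsetP=> w /KP[].
split=> //; apply/forall_inP => x /setU1P[->|xK]; apply/forall_inP => y /setU1P[->|yK].
- by rewrite eqxx.
- by rewrite (KP y yK).2 implybT.
- by rewrite edge_sym (KP x xK).2 implybT.
- by move/forall_inP/(_ x xK)/forall_inP: clK; apply.
Qed.

Lemma pmc_card (V : finType) (G : simple_graph V) (k s : nat) (O : {set V}) :
    0 < k -> 0 < s -> (forall K, clique G K -> #|K| <> k) ->
    (forall X, minimal_separator G X -> #|X| <= s) ->
  potential_maximal_clique G O -> #|O| <= (k - 1) * s ^ 3.
Proof.
move=> k_gt0 s_gt0 noK small pmcO; rewrite leqNgt; apply/negP => big.
have [v vO|K _ [/noK nK cK]] := clique_of_few_nonneighbors (G := G) _ big.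
  exact: pmc_nonneighbors_card.
by case: nK; rewrite cK subn1 prednK.
Qed.

(** * Turning a separator into a clique, and back *)

Section Saturation.
Variables (V : finType) (G : simple_graph V) (S : {set V}).
Implicit Types (C D O : {set V}) (p q u v w x y z : V).

Definition saturated_edge : rel V :=
  fun x y => G x y || [&& x != y, x \in S & y \in S].

Lemma saturated_edge_sym : symmetric saturated_edge.
Proof.
by move=> x y; rewrite /saturated_edge edge_sym eq_sym [(x \in S) && _]andbC.
Qed.

Lemma saturated_edge_irr : irreflexive saturated_edge.
Proof. by move=> x; rewrite /saturated_edge edge_irr eqxx. Qed.

Definition saturate : simple_graph V :=
  SimpleGraph saturated_edge_sym saturated_edge_irr.

Lemma saturateE x y : saturate x y = G x y || [&& x != y, x \in S & y \in S].
Proof. by []. Qed.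

Lemma saturate_off x y : y \notin S -> saturate x y = G x y.
Proof. by move=> /negPf yS; rewrite saturateE yS !andbF orbF. Qed.

Lemma touches_saturate w D : touches G w D -> touches saturate w D.
Proof.
by move=> /touchesP[d dD wd]; apply/touchesP; exists d; rewrite // saturateE wd.
Qed.

Lemma touches_saturate_off w D :
  D \subset ~: S -> touches saturate w D -> touches G w D.
Proof.
move=> DS /touchesP[d dD wd]; apply/touchesP; exists d => //.
by rewrite saturate_off in wd => //; move/subsetP/(_ d dD): DS; rewrite inE.
Qed.

Lemma connected_saturate D : connected_set G D -> connected_set saturate D.
Proof.
move=> cD x y xD yD; apply: (connect_homo (f := id)) (cD _ _ xD yD) => a b.
rewrite inducedE => /and3P[aD bD ab]; apply: connect_induced1 => //.
by rewrite saturateE ab.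
Qed.

Lemma connected_saturate_off D :
  D \subset ~: S -> connected_set saturate D -> connected_set G D.
Proof.
move=> /subsetP DS cD x y xD yD.
apply: (connect_homo (f := id)) (cD _ _ xD yD) => a b.
rewrite inducedE => /and3P[aD bD]; rewrite saturate_off; last first.
  by have := DS b bD; rewrite inE.
exact: connect_induced1.
Qed.

(* A side of [S] links any two vertices of [S], hence replaces the new edges. *)
Lemma connected_saturate_side C D : connected_set G C ->
    (forall x, x \in S -> touches G x C) -> ~~ (D \subset ~: S) ->
  connected_set saturate D -> connected_set G (D :|: C).
Proof.
move=> cC fC /subsetPn[y yD]; rewrite inE negbK => yS cD.
have CDC : C \subset D :|: C := subsetUr _ _.
have inl x : x \in D -> x \in D :|: C by move=> xD; rewrite inE xD.
suff cy x : x \in D :|: C -> connect (induced G (D :|: C)) y x.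
  by move=> x z /cy + /cy; rewrite induced_csym; apply: connect_trans.
case/setUP=> xE.
  apply: (connect_homo (f := id)) (cD _ _ yD xE) => a b.
  rewrite inducedE => /and3P[aD bD]; rewrite saturateE.
  case/orP => [ab|/and3P[_ aS bS]]; first by apply: connect_induced1; rewrite ?inl.
  by apply: connect_touches2 cC CDC _ _ (fC _ _) (fC _ _) => //; apply: inl.
by rewrite induced_csym; apply: connect_touches cC CDC xE (inl _ yD) (fC _ yS).
Qed.

(** Since [D] avoids [S], its inner links and its contacts with [p] and [w] are edges of [G], so
    they carry membership in the component from [p] to [w]. *)
Lemma component_step r p w D :
    r \notin S -> p \in component G (~: S) r -> D \subset ~: S ->
    connected_set saturate D -> touches saturate p D -> touches saturate w D ->
    w \notin S -> w \in component G (~: S) r.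
Proof.
move=> rS pC DS cD /(touches_saturate_off DS)/touchesP[d dD pd].
move=> /(touches_saturate_off DS)/touchesP[e eD we] wS.
have rS' : r \in ~: S by rewrite inE.
have clC y z := @component_closed _ G (~: S) r y z rS'.
have dC : d \in component G (~: S) r by apply: clC pC _ pd; apply: (subsetP DS).
have := connected_absorb (connected_saturate_off DS cD) DS dD dC clC.
move=> /subsetP/(_ e eD) eC; apply: clC eC _ _; first by rewrite inE.
by rewrite edge_sym.
Qed.

Variable O : {set V}.
Hypothesis pmcO : potential_maximal_clique saturate O.

(* If both sides met [O] in [p] and [q], a component of the complement of [O]
   touched by [p] and [q] would contain [S :\: O]; a vertex of [O] that it does
   not touch would then lie on both sides. *)
Lemma pmc_saturate_side u v : separator G u v S ->
  (component G (~: S) u \subset ~: O) || (component G (~: S) v \subset ~: O).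
Proof.
move=> /and3P[uS vS nuv]; apply: contraT; rewrite negb_or.
case/andP => /subsetPn[p pC /[!inE] /negbNE pO] /subsetPn[q qC /[!inE] /negbNE qO].
have uS' : u \in ~: S by rewrite inE.
have vS' : v \in ~: S by rewrite inE.
have off r x : r \notin S -> x \in component G (~: S) r -> x \notin S.
  move=> rS xC; have /subsetP/(_ _ xC) : component G (~: S) r \subset ~: S.
    by apply: component_sub; rewrite inE.
  by rewrite inE.
have disj x : x \in component G (~: S) u -> x \in component G (~: S) v -> False.
  rewrite !inE => ux vx; case/negP: nuv; apply: connect_trans ux _.
  by rewrite induced_csym.
have pS := off _ _ uS pC; have qS := off _ _ vS qC.
have pq : p != q by apply/eqP => e; apply: (disj p) => //; rewrite e.
have npq : ~~ saturate p q.
  rewrite saturate_off //; apply/negP => e; apply: (disj q) => //.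
  by apply: component_closed pC _ e => //; rewrite inE.
have [D [cD DO pD qD]] := pmcO.1 p q pO qO pq npq.
(* If [D] avoided [S], it would join [p] to [q] in [G] without meeting [S]. *)
have [DS|/subsetPn[y yD /[!inE] /negbNE yS]] := boolP (D \subset ~: S).
  by case: (disj q); rewrite // (component_step uS pC DS cD).
have yO : y \in ~: O by apply: (subsetP DO).
set E := component saturate (~: O) y.
have yE : y \in E by apply: mem_component.
have DE : D \subset E by apply: component_max.
have [|z zO nzE] := pmcO.2 E _ (@component_connected _ _ _ _ yO) (component_sub _ yO).
  by apply/set0Pn; exists y.
have zS : z \notin S.
  apply: contra nzE => zS; apply/touchesP; exists y => //.
  rewrite saturateE zS yS !andbT; apply/orP; right; apply: contraTneq zO => ->.
  by rewrite inE in yO.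
have side r x : r \notin S -> x \in component G (~: S) r -> x \in O ->
    touches saturate x D -> z \in component G (~: S) r.
  move=> rS xC xO xD; have xS := off _ _ rS xC.
  have xz : x != z by apply: contraNneq nzE => <-; apply: touchesS xD.
  have [xz'|nxz] := boolP (saturate x z).
    rewrite saturate_off // in xz'; by apply: component_closed xC _ xz'; rewrite inE.
  have [D2 [cD2 DO2 xD2 zD2]] := pmcO.1 x z xO zO xz nxz.
  (* If [D2] meets [S] in [t], then [t] is in [E], because [S] is a clique after saturation and
     contains [y]. So [D2] lies in [E], which [z] does not touch. *)
  have [DS2|/subsetPn[t tD2 /[!inE] /negbNE tS]] := boolP (D2 \subset ~: S).
    exact: component_step xC DS2 cD2 xD2 zD2 zS.
  have tO := subsetP DO2 t tD2.
  have tE : t \in E.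
    have [->//|ty] := eqVneq t y.
    by apply: component_closed yE tO _; rewrite // saturateE tS yS eq_sym ty orbT.
  case/negP: nzE; apply: touchesS zD2.
  by apply: connected_absorb cD2 DO2 tD2 tE _ => a b; apply: component_closed.
by case: (disj z); [apply: side pC pO pD | apply: side qC qO qD].
Qed.

(** A side [C] of [S] that avoids [O] and is touched by all of [S] makes up for the lost edges: it
    witnesses (i) for pairs adjacent only after saturation, and is added to a witness [D] that meets
    [S]. Condition (ii) survives since [G] has fewer edges. *)
Lemma pmc_desaturate u v : minimal_st_separator G u v S ->
  potential_maximal_clique G O.
Proof.
move=> mS; have mS' := minimal_st_separator_sym mS.
have [C [cC CO fC]] : exists C, [/\ connected_set G C, C \subset ~: O &
    forall x, x \in S -> touches G x C].
  have /minsetP[sS _] := mS; have /and3P[uS vS _] := sS.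
  case/orP: (pmc_saturate_side sS) => CO.
    exists (component G (~: S) u); split=> //; last exact: minimal_separator_full mS.
    by apply: component_connected; rewrite inE.
  exists (component G (~: S) v); split=> //; last exact: minimal_separator_full mS'.
  by apply: component_connected; rewrite inE.
split=> [x y xO yO xy nxy|D D0 cD DO]; last first.
  have [z zO nz] := pmcO.2 D D0 (connected_saturate cD) DO.
  by exists z => //; apply: contra nz; apply: touches_saturate.
have [|nxy'] := boolP (saturate x y).
  by rewrite saturateE (negPf nxy) => /and3P[_ /fC xC /fC yC]; exists C.
have [D [cD DO xD yD]] := pmcO.1 x y xO yO xy nxy'.
have [DS|DS] := boolP (D \subset ~: S).
  by exists D; split=> //; [apply: connected_saturate_off|exact: touches_saturate_off..].
have tDC w : touches saturate w D -> touches G w (D :|: C).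
  case/touchesP => d dD; rewrite saturateE => /orP[wd|/and3P[_ /fC wC _]].
    by apply/touchesP; exists d; rewrite // inE dD.
  exact: touchesS (subsetUr _ _) wC.
exists (D :|: C); split; rewrite ?subUset ?DO ?tDC //.
exact: connected_saturate_side.
Qed.

End Saturation.

(** * Cliques in chordal graphs *)

Lemma cliqueP (V : finType) (G : simple_graph V) (K : {set V}) :
  reflect {in K &, forall x y, x != y -> G x y} (clique G K).
Proof.
apply: (iffP forall_inP) => [clK x y xK yK|clK x xK].
  by move/forall_inP/(_ y yK)/implyP: (clK x xK).
by apply/forall_inP => y yK; apply/implyP; apply: clK.
Qed.

Lemma not_cliqueP (V : finType) (G : simple_graph V) (K : {set V}) :
  ~~ clique G K -> exists x y, [/\ x \in K, y \in K, x != y & ~~ G x y].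
Proof.
case/forall_inPn => x xK /forall_inPn[y yK]; rewrite negb_imply => /andP[xy nxy].
by exists x, y.
Qed.

(** This is chordality, stated through separators instead of chords of cycles. *)
Definition separated_by_cliques (V : finType) (G : simple_graph V) : Prop :=
  forall u v, u != v -> ~~ G u v -> exists2 T, clique G T & separator G u v T.

Section Chordal.
Variables (V : finType) (H : simple_graph V).
Hypothesis sepH : separated_by_cliques H.
Implicit Types (A B D K O T W : {set V}).

(* A clique separating [d] from [u] contains [W] and meets the path, so some
   later vertex of the path is adjacent to all of [W]. *)
Lemma neighborhood_climb D W u p d :
    u \notin D -> [disjoint W & D] -> {in W, forall w, H u w} ->
    {in W, forall w, H d w} -> path H d p -> {subset d :: p <= D} ->
    H (last d p) u ->
  exists2 d', d' \in D & H d' u /\ {in W, forall w, H d' w}.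
Proof.
move=> uD WD uW; have [n] := ubnP (size p); elim: n p d => // n IHn p d size_p.
move=> dW pathp pD lastu; have dD : d \in D by rewrite pD ?mem_head.
have [du|ndu] := boolP (H d u); first by exists d.
have neq_du : d != u by apply: contraNneq uD => <-.
have [T clT /and3P[dT uT nconn]] := sepH neq_du ndu.
have WT : W \subset T.
  apply/subsetP => w wW; apply: contraR nconn => wT.
  apply: (@connect_trans _ _ w); apply: connect_induced1; rewrite ?inE ?dW //.
  by rewrite edge_sym uW.
have [/hasP[t tp tT]|noT] := boolP (has (mem T) p).
  case/splitPr: tp size_p pathp pD lastu => p1 p2; rewrite size_cat /= => size_p.
  rewrite cat_path last_cat /= => /and3P[_ _ pathp2] pD lastu.
  have sub x : x \in t :: p2 -> x \in D.
    by move=> xp; apply: pD; rewrite inE mem_cat xp !orbT.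
  apply: (IHn p2 t) => //; first by lia.
  move=> w wW; move/cliqueP: clT; apply=> //; first exact: (subsetP WT).
  by apply: contraTneq (sub t (mem_head _ _)) => ->; rewrite (disjointFr WD).
case/negP: nconn.
have lastT : last d p \notin T.
  by move: (mem_last d p); rewrite inE => /orP[/eqP->//|]; apply: (hasPn noT).
apply: (@connect_trans _ _ (last d p)); last first.
  by apply: connect_induced1; rewrite ?inE.
apply/connectP; exists p => //.
elim: p d dT noT pathp {IHn size_p dW pD lastu dD ndu neq_du lastT} => //= y p IHp d dT.
rewrite negb_or => /andP[yT noT] /andP[dy pathp].
by rewrite inducedE !in_setC dT yT dy; apply: IHp.
Qed.

(** The vertices of [O] are treated one at a time: given [d] adjacent to those already treated, a
    path in [D] from [d] to a neighbour of the next vertex [u] can be climbed to a vertex adjacent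
    to [u] as well. *)
Lemma connected_touches_clique D O : D != set0 -> connected_set H D ->
    [disjoint O & D] -> clique H O -> {in O, forall w, touches H w D} ->
  exists2 d, d \in D & {in O, forall w, H d w}.
Proof.
move=> /set0Pn[d0 d0D] cD OD /cliqueP clO tO.
suff [d dD dP] : exists2 d, d \in D & {in enum O, forall w, H d w}.
  by exists d => // w wO; apply: dP; rewrite mem_enum.
have: {subset enum O <= O} by move=> w; rewrite mem_enum.
have := enum_uniq O; elim: (enum O) => [_ _|u r IHr /andP[ur Ur] sub].
  by exists d0.
have uO : u \in O by rewrite sub ?mem_head.
have rO w : w \in r -> w \in O by move=> wr; rewrite sub ?inE ?wr ?orbT.
have [d dD dr] := IHr Ur rO.
have /touchesP[e eD ue] := tO u uO.
have /connectP[p pathp lastp] := cD _ _ dD eD.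
have pD : {subset d :: p <= D}.
  elim: p d dD pathp {lastp dr} => [|y p IHp] d dD /=.
    by move=> _ x; rewrite inE => /eqP->.
  move=> /andP[/andP[/andP[_ yD] _] /(IHp y yD) sp] x.
  by rewrite inE => /orP[/eqP->//|/sp].
have pathH : path H d p by apply: sub_path pathp => x y /andP[].
have [|||||d' d'D [d'u d'r]] := @neighborhood_climb D [set w in r] u p d _ _ _ _ pathH pD.
- by rewrite (disjointFr OD).
- by rewrite disjoint_subset; apply/subsetP => w /[!inE] /rO wO; rewrite (disjointFr OD).
- move=> w /[!inE] wr; apply: clO => //; first exact: rO.
  by apply: contraNneq ur => ->.
- by move=> w /[!inE]; apply: dr.
- by rewrite -lastp edge_sym.
by exists d' => // w; rewrite inE => /orP[/eqP->//|wr]; apply: d'r; rewrite inE.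
Qed.

(** Condition (i) is vacuous on a clique. If (ii) failed for [D], some [d] in [D] would be adjacent
    to all of [O], and [d |: O] would be a larger clique. *)
Lemma maximal_clique_pmc O : maxset (clique H) O -> potential_maximal_clique H O.
Proof.
move=> /maxsetP[clO maxO]; split=> [u v uO vO uv|D D0 cD DO].
  by rewrite (cliqueP _ _ clO).
have OD : [disjoint O & D] by rewrite disjoint_sym disjoints_subset.
apply/exists_inP; apply: contraT; rewrite negb_exists_in => /forall_inP nt.
have [|d dD dO] := connected_touches_clique D0 cD OD clO.
  by move=> w /nt; rewrite negbK.
have /negP[] : d \notin O by move/subsetP/(_ d dD): DO; rewrite inE.
rewrite -(maxO (d |: O)) ?setU11 ?subsetUr //.
apply/cliqueP => x y /setU1P[->|xO] /setU1P[->|yO]; rewrite ?eqxx //.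
- by rewrite dO.
- by rewrite edge_sym dO.
- exact: (cliqueP _ _ clO).
Qed.

End Chordal.

(** * Joining two trees by an edge *)

Lemma has_split (T : Type) (P : pred T) (s : seq T) : has P s ->
  exists s1 x s2, [/\ s = s1 ++ x :: s2, P x & ~~ has P s1].
Proof.
by case/split_find => x s1 s2 Px nPs1; exists s1, x, s2; rewrite cat_rcons.
Qed.

Section Bridge.
Variables (I1 I2 : finType) (T1 : simple_graph I1) (T2 : simple_graph I2).
Variables (i1 : I1) (i2 : I2).

Definition bridge_edge : rel (I1 + I2) := fun x y =>
  match x, y with
  | inl a, inl b => T1 a b
  | inr a, inr b => T2 a b
  | inl a, inr b | inr b, inl a => (a == i1) && (b == i2)
  end.

Lemma bridge_edge_sym : symmetric bridge_edge.
Proof. by move=> [a|a] [b|b] //=; rewrite edge_sym. Qed.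

Lemma bridge_edge_irr : irreflexive bridge_edge.
Proof. by move=> [a|a] /=; rewrite edge_irr. Qed.

Definition bridge : simple_graph (I1 + I2)%type :=
  SimpleGraph bridge_edge_sym bridge_edge_irr.

Lemma all_is_inl (c : seq (I1 + I2)) : all is_inl c -> exists c', c = map inl c'.
Proof.
elim: c => [|[a|//] c IHc] /=; first by exists [::].
by move/IHc => [c' ->]; exists (a :: c').
Qed.

Lemma all_is_inr (c : seq (I1 + I2)) : ~~ has is_inl c -> exists c', c = map inr c'.
Proof.
elim: c => [|[//|b] c IHc] /=; first by exists [::].
by move/IHc => [c' ->]; exists (b :: c').
Qed.

Lemma bridge_cross x y : bridge x y -> is_inl x != is_inl y ->
  (x, y) = (inl i1, inr i2) \/ (x, y) = (inr i2, inl i1).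
Proof.
by case: x y => [a|a] [b|b] //= /andP[/eqP-> /eqP->]; [left | right].
Qed.

(* A cycle on both sides uses the bridge in both directions, and its vertices
   are distinct. *)
Lemma bridge_acyclic : acyclic T1 -> acyclic T2 -> acyclic bridge.
Proof.
move=> ac1 ac2 c /andP[cyc_c uniq_c].
have [|/all_is_inr[c' def_c]] := boolP (has is_inl c); last first.
  rewrite def_c size_map; apply: ac2; apply/andP; split.
    by move: cyc_c; rewrite def_c cycle_map.
  by move: uniq_c; rewrite def_c map_inj_uniq // => ? ? [].
case/hasP => x xc x_inl; have [n p def_c] := rot_to xc.
rewrite -(size_rot n); move: cyc_c uniq_c.
rewrite -(rot_cycle n) -(rot_uniq n) def_c.
case: x x_inl {xc def_c} => // a _ cyc_c uniq_c.
have [|no_inr] := boolP (has (predC is_inl) p); last first.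
  have [|c' def_c] := @all_is_inl (inl a :: p).
    by move: no_inr; rewrite -all_predC; apply: sub_all => x /negbNE.
  rewrite def_c size_map; apply: ac1; apply/andP; split.
    by move: cyc_c; rewrite def_c cycle_map.
  by move: uniq_c; rewrite def_c map_inj_uniq // => ? ? [].
(* The cycle starts on the left at [inl a], and [b] is its first vertex on the right, so the bridge
   is crossed just before [b]. *)
case/has_split => p1 [b [p2 [def_p b_inr p1_inl]]]; move: cyc_c uniq_c.
rewrite def_p /= rcons_cat cat_path /= => /and3P[_ ab].
have a_last: is_inl (last (inl a) p1).
  by move: p1_inl (mem_last (inl a) p1) => /hasPn H /[!inE] /orP[/eqP->//|/H /negbNE].
have [|[la bi]|[la]] := bridge_cross ab; first by rewrite a_last (negPf b_inr).
  2: by rewrite la in a_last.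
(* From [b] on to the closing [inl a], the first vertex back on the left is [d], reached by the
   bridge again. *)
have /has_split[q1 [d [q2 [def_q d_inl q1_inr]]]] : has is_inl (rcons p2 (inl a)).
  by rewrite has_rcons.
rewrite def_q cat_path /= => /and3P[_ bd _].
have b_last: is_inl (last b q1) = false.
  move: (q1_inr) (mem_last b q1) => /hasPn H /[!inE] /orP[/eqP->|/H /negPf->//].
  exact: negPf.
have [|[lb]|[lb di]] := bridge_cross bd; first by rewrite b_last d_inl.
  by rewrite lb in b_last.
rewrite mem_cat inE cat_uniq /= !negb_or.
case/and3P => /and3P[ap1 ab' ap2] up1 /and3P[/andP[bp1 p1p2] bp2 up2].
(* The way back leaves from [b] itself, so distinctness forces [q1] to be empty. As [d] is also the
   last vertex of [inl a :: p1], it can only be the closing [inl a]; this empties [p2] and then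
   [p1], leaving two vertices. *)
case: q1 => [|y q1] in def_q lb q1_inr b_last bd *; last first.
  case/negP: bp2; have : b \in rcons p2 (inl a).
    by rewrite def_q mem_cat {1}(etrans bi (esym lb) : b = last y q1) mem_last.
  by rewrite mem_rcons inE eq_sym (negPf ab').
case: p2 => [|y p2] in def_p def_q ap2 bp2 up2 p1p2 *; last first.
  move: def_q; rewrite /= => -[yd _]; move: p1p2 ap2; rewrite yd di -la /= negb_or inE negb_or.
  case/andP => lp1 _ /andP[al _]; move: (mem_last (inl a) p1).
  by rewrite inE eq_sym (negPf al) (negPf lp1).
case: (p1) ap1 la => [//|y r] ap1 la; move: def_q; rewrite /= => -[ad _].
by case/negP: ap1; rewrite ad di -la /= mem_last.
Qed.

Lemma bridge_connect_inl (B : I1 + I2 -> bool) x y :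
  connect (induced T1 [set i | B (inl i)]) x y ->
  connect (induced bridge [set i | B i]) (inl x) (inl y).
Proof.
apply: (connect_homo (f := inl)) => {}x {}y.
by rewrite inducedE !inE => /and3P[? ? ?]; apply: connect_induced1; rewrite ?inE.
Qed.

Lemma bridge_connect_inr (B : I1 + I2 -> bool) x y :
  connect (induced T2 [set i | B (inr i)]) x y ->
  connect (induced bridge [set i | B i]) (inr x) (inr y).
Proof.
apply: (connect_homo (f := inr)) => {}x {}y.
by rewrite inducedE !inE => /and3P[? ? ?]; apply: connect_induced1; rewrite ?inE.
Qed.

Lemma bridge_tree : tree T1 -> tree T2 -> tree bridge.
Proof.
move=> [I1_gt0 c1 ac1] [_ c2 ac2]; split; last exact: bridge_acyclic.
  by rewrite card_sum addn_gt0 I1_gt0.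
have cinl x y : connect bridge (inl x) (inl y).
  by apply: (connect_homo (f := inl)) (c1 x y) => *; apply: connect1.
have cinr x y : connect bridge (inr x) (inr y).
  by apply: (connect_homo (f := inr)) (c2 x y) => *; apply: connect1.
have b12 : connect bridge (inl i1) (inr i2) by apply: connect1; rewrite /= !eqxx.
have b21 : connect bridge (inr i2) (inl i1) by apply: connect1; rewrite /= !eqxx.
case=> x [] y //.
  by apply: connect_trans (cinl x i1) (connect_trans b12 _).
by apply: connect_trans (cinr x i2) (connect_trans b21 _).
Qed.

End Bridge.

(** * Clique trees *)

Section CliqueTree.
Variables (V : finType) (H : simple_graph V).
Hypothesis sepH : separated_by_cliques H.

(** Asking for a bag around every clique, rather than every edge, provides the bags at which two
    such trees can be joined. *)
Definition clique_tree (A : {set V}) (I : finType) (T : simple_graph I)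
    (B : I -> {set V}) : Prop :=
  [/\ tree T,
      forall i, B i \subset A /\ clique H (B i),
      forall K : {set V}, K \subset A -> clique H K -> exists i, K \subset B i
    & forall v i j, v \in B i -> v \in B j ->
        connect (induced T [set l | v \in B l]) i j].

Lemma clique_tree_clique (A : {set V}) : clique H A ->
  exists (I : finType) (T : simple_graph I) (B : I -> {set V}), clique_tree A T B.
Proof.
move=> clA.
have sym0 : symmetric (fun _ _ : unit => false) by [].
have irr0 : irreflexive (fun _ _ : unit => false) by [].
exists unit, (SimpleGraph sym0 irr0), (fun=> A); split.
- split; [by rewrite card_unit | by move=> [] []; apply: connect0 |].
  by move=> [|x [|y c]] //= /andP[].
- by [].
- by move=> K KA _; exists tt.
- by move=> v [] [] *; apply: connect0.
Qed.

(** The bridge joins two bags that contain [A1 :&: A2]. A vertex with bags on both sides lies in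
    this intersection, hence in both ends of the bridge. *)
Lemma clique_tree_glue (A1 A2 : {set V}) (I1 I2 : finType) (T1 : simple_graph I1)
    (T2 : simple_graph I2) (B1 : I1 -> {set V}) (B2 : I2 -> {set V}) :
    clique_tree A1 T1 B1 -> clique_tree A2 T2 B2 -> clique H (A1 :&: A2) ->
    (forall K : {set V}, K \subset A1 :|: A2 -> clique H K -> K \subset A1 \/ K \subset A2) ->
  exists (I : finType) (T : simple_graph I) (B : I -> {set V}),
    clique_tree (A1 :|: A2) T B.
Proof.
move=> [tree1 cl1 K1 c1] [tree2 cl2 K2 c2] clA K12.
have [i1 Ai1] := K1 _ (subsetIl _ _) clA; have [i2 Ai2] := K2 _ (subsetIr _ _) clA.
pose B i := match i with inl i => B1 i | inr i => B2 i end.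
exists (I1 + I2)%type, (bridge T1 T2 i1 i2), B; split.
- exact: bridge_tree.
- by case=> i /=; [have [sB ?] := cl1 i | have [sB ?] := cl2 i]; split=> //;
    apply: subset_trans sB _; rewrite ?subsetUl ?subsetUr.
- move=> K KA clK; case: (K12 K KA clK) => KAi.
    by have [i Ki] := K1 K KAi clK; exists (inl i).
  by have [i Ki] := K2 K KAi clK; exists (inr i).
move=> v.
have cl x y : v \in B1 x -> v \in B1 y ->
    connect (induced (bridge T1 T2 i1 i2) [set l | v \in B l]) (inl x) (inl y).
  by move=> vx vy; apply: (@bridge_connect_inl _ _ _ _ _ _ (fun i => v \in B i)); apply: c1.
have cr x y : v \in B2 x -> v \in B2 y ->
    connect (induced (bridge T1 T2 i1 i2) [set l | v \in B l]) (inr x) (inr y).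
  by move=> vx vy; apply: (@bridge_connect_inr _ _ _ _ _ _ (fun i => v \in B i)); apply: c2.
have clr x y : v \in B1 x -> v \in B2 y ->
    connect (induced (bridge T1 T2 i1 i2) [set l | v \in B l]) (inl x) (inr y).
  move=> vx vy; have vA : v \in A1 :&: A2.
    by rewrite inE (subsetP (cl1 x).1) // (subsetP (cl2 y).1).
  have v1 := subsetP Ai1 v vA; have v2 := subsetP Ai2 v vA.
  apply: connect_trans (cl _ _ vx v1) (connect_trans _ (cr _ _ v2 vy)).
  by apply: connect_induced1; rewrite ?inE //= !eqxx.
move=> [i|i] [j|j] /= vi vj; [exact: cl | exact: clr | | exact: cr].
by rewrite induced_csym; apply: clr.
Qed.

(** Induction on the size of [A], cutting along a clique [S] that separates two nonadjacent vertices
    [a] and [b]. The part [A1] lacks [b] and [A2] lacks [a]. A clique meeting the component [C] of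
    [a] stays in [C :|: S], so no clique is cut. *)
Lemma clique_tree_exists (A : {set V}) :
  exists (I : finType) (T : simple_graph I) (B : I -> {set V}), clique_tree A T B.
Proof.
have [n] := ubnP #|A|; elim: n A => // n IHn A; rewrite ltnS => cardA.
have [/clique_tree_clique//|/not_cliqueP[a [b [aA bA ab nab]]]] := boolP (clique H A).
have [S clS /and3P[aS bS nconn]] := sepH ab nab.
have aS' : a \in ~: S by rewrite inE.
pose C := component H (~: S) a.
have aC : a \in C by apply: mem_component.
have bC : b \notin C by rewrite inE.
have CS x : x \in C -> x \notin S.
  by move/(subsetP (component_sub H aS')); rewrite inE.
have clC x y : x \in C -> H x y -> y \notin S -> y \in C.
  by move=> xC xy yS; apply: component_closed xC _ xy; rewrite ?inE.
pose A1 := A :&: (C :|: S); pose A2 := A :\: C.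
have defA : A1 :|: A2 = A.
  apply/setP => x; rewrite !inE; case: (x \in A); case: (x \in S);
  by rewrite ?andbF ?orbF ?orbT //=; case: connect.
have [I1 [T1 [B1 dec1]]] : exists (I : finType) (T : simple_graph I) B, clique_tree A1 T B.
  apply: IHn; apply: leq_trans cardA; apply: proper_card.
  apply/properP; split; first exact: subsetIl.
  by exists b; rewrite // !in_setI in_setU (negPf bC) (negPf bS) andbF.
have [I2 [T2 [B2 dec2]]] : exists (I : finType) (T : simple_graph I) B, clique_tree A2 T B.
  apply: IHn; apply: leq_trans cardA; apply: proper_card.
  apply/properP; split; first exact: subsetDl.
  by exists a; rewrite // in_setD aC.
rewrite -defA; apply: clique_tree_glue dec1 dec2 _ _.
  apply/cliqueP => x y.
  have sub z : z \in A1 :&: A2 -> z \in S.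
    by rewrite in_setI in_setD in_setI in_setU => /andP[/andP[_ /orP[->|]]].
  by move=> /sub xS /sub yS; apply: (cliqueP _ _ clS).
rewrite defA => K KA clK.
have [KC|/pred0Pn[x /andP[/= xK xC]]] := boolP [disjoint K & C].
  by right; rewrite subsetD KA.
left; rewrite subsetI KA; apply/subsetP => y yK; rewrite in_setU.
have [->|xy] := eqVneq y x; first by rewrite xC.
have [|yS] := boolP (y \in S); first by rewrite orbT.
by rewrite (clC x y) // (cliqueP _ _ clK) // eq_sym.
Qed.

End CliqueTree.

(** * Decompositions into potential maximal cliques, and the bound *)

(** Only inclusion in [O] is asked, since the bags of a clique tree may be cliques that are not
    maximal. *)
Definition pmc_decomposition (V : finType) (G : simple_graph V) : Prop :=
  exists (I : finType) (T : simple_graph I) (B : I -> {set V}),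
    tree_decomposition G T B /\
    forall i, exists2 O : {set V}, B i \subset O & potential_maximal_clique G O.

Lemma pmc_decomposition_chordal (V : finType) (G : simple_graph V) :
  separated_by_cliques G -> pmc_decomposition G.
Proof.
move=> sepG; have [I [T [B [treeT clB KB cB]]]] := clique_tree_exists sepG setT.
exists I, T, B; split; last first.
  move=> i; have [O maxO BO] := maxset_exists (clB i).2.
  by exists O; last exact: maximal_clique_pmc.
split=> // [v|u v uv].
  have [||i vi] := KB [set v]; first exact: subsetT.
    by apply/cliqueP => x y /set1P-> /set1P->; rewrite eqxx.
  by exists i; rewrite -sub1set.
have [||i vi] := KB [set u; v]; first exact: subsetT.
  by apply/cliqueP => x y /set2P[]-> /set2P[]->; rewrite ?eqxx // edge_sym.
by exists i; move: vi; rewrite subUset !sub1set.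
Qed.

(** Induction on the number of nonadjacent ordered pairs, which drops when a minimal separator that
    is not a clique is saturated. A decomposition of the supergraph also decomposes [G]. *)
Lemma pmc_decomposition_exists (V : finType) (G : simple_graph V) :
  pmc_decomposition G.
Proof.
have [n] := ubnP #|[set p : V * V | ~~ G p.1 p.2]|; elim: n G => // n IHn G.
rewrite ltnS => size_G.
have [/pmc_decomposition_chordal//|nsep] := pselect (separated_by_cliques G).
(* If all minimal separators were cliques, those of nonadjacent pairs would make [G] separated by
   cliques. *)
have [u [v [S [mS nclS]]]] : exists u v S, minimal_st_separator G u v S /\ ~~ clique G S.
  apply: contrapT => none; apply: nsep => u v uv nuv.
  have [S mS] := minimal_st_separator_exists uv nuv.
  exists S; last by case/minsetP: mS.
  by apply: contrapT => /negP nclS; case: none; exists u, v, S.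
have [x [y [xS yS xy nxy]]] := not_cliqueP nclS.
have [|I [T [B [[treeT vB eB cB] pmcB]]]] := IHn (saturate G S).
  apply: leq_trans size_G; apply: proper_card; apply/properP; split.
    by apply/subsetP => p; rewrite !inE negb_or => /andP[].
  by exists (x, y); rewrite !inE // saturateE xy xS yS orbT.
exists I, T, B; split.
  by split=> // a b ab; apply: eB; rewrite saturateE ab.
by move=> i; have [O BO pmcO] := pmcB i; exists O; last exact: (pmc_desaturate pmcO mS).
Qed.

Lemma treewidth_le (V : finType) (G : simple_graph V) (I : finType)
    (T : simple_graph I) (B : I -> {set V}) (m : nat) :
  tree_decomposition G T B -> (forall i, #|B i| <= m) -> (treewidth G <= m%:Z - 1)%R.
Proof.
move=> decB Bm; rewrite /treewidth; case: ex_minnP => w _ minw.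
have: w <= \max_i #|B i| by apply: minw; apply/asboolP; exists I, T, B.
by have: \max_i #|B i| <= m by [apply/bigmax_leqP]; lia.
Qed.

Theorem theorem2p1 (V : finType) (G : simple_graph V) (k s : nat)
    (k_ge2 : 2 <= k) (s_ge1 : 1 <= s)
    (no_clique : ~ exists K : {set V}, clique G K /\ #|K| = k)
    (no_large_separator :
       ~ exists X : {set V}, minimal_separator G X /\ s < #|X|) :
  (treewidth G <= ((k - 1) * s ^ 3)%N%:Z - 1)%R.
Proof.
have [I [T [B [decB pmcB]]]] := pmc_decomposition_exists G.
apply: treewidth_le decB _ => i; have [O BO pmcO] := pmcB i.
apply: leq_trans (subset_leq_card BO) _; apply: pmc_card pmcO => //.
- exact: ltnW.
- by move=> K clK cK; apply: no_clique; exists K.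
- by move=> X mX; rewrite leqNgt; apply/negP => sX; apply: no_large_separator; exists X.
Qed.
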